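(* Consider the symmetric $n$-firm dynamic advertising oligopoly described in the context, and assume there is no spillover effect of advertising investment, i.e. $\frac{\partial \Gamma(k_i,K_{-i})}{\partial K_{-i}}=0$ identically. Let $A^{*}$ be the steady state value of $A_i(t)$ in the open-loop solution and $A^{**}$ the steady state value of $A_i(t)$ in the memoryless closed-loop solution. \begin{enumerate} \item If the outputs of the firms are strategic substitutes, then $A^{**}>A^{*}$. \item If the outputs of the firms are strategic complements, then $A^{**}<A^{*}$. \end{enumerate}
   Context: Model. There are $n\ge 2$ firms. At time $t\in[0,\infty)$ Firm $i$ chooses output $q_i(t)$ and advertising investment $k_i(t)$ (both positive). The price of good $i$ is $p_i=p_i(A_i(t),q_1(t),\dots,q_n(t))$, where $A_i(t)$ is the accumulated effect of advertising (market size) of good $i$. The inverse demands are symmetric across firms: $p_i=P(A_i,q_i,(q_j)_{j\ne i})$ with a common function $P$ that is symmetric in its last $n-1$ arguments. For $j\ne i$: $\frac{\partial p_i}{\partial q_i}<0$, $\frac{\partial p_i}{\partial q_j}<0$, $\frac{\partial p_i}{\partial A_i}>0$, and $\frac{\partial p_i}{\partial A_i}+\frac{\partial^2 p_i}{\partial A_i\partial q_i}q_i>0$. Outputs are strategic substitutes if $\frac{\partial p_j}{\partial q_i}+\frac{\partial^2 p_j}{\partial q_i\partial q_j}q_j<0$ for all $j\ne i$, and strategic complements if $\frac{\partial p_j}{\partial q_i}+\frac{\partial^2 p_j}{\partial q_i\partial q_j}q_j>0$ for all $j\ne i$. The production cost is $c(q_i)>0$ with $c'>0$, $c''\ge 0$;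 the advertising cost is $\gamma(k_i)>0$ with $\gamma'>0$, $\gamma''>0$. The state equations are $$\frac{dA_i}{dt}=\Gamma_i-\delta A_i,\qquad \Gamma_i=\Gamma(k_i,K_{-i}),\quad K_{-i}=\sum_{j\ne i}k_j,\quad \delta>0,$$ with $\Gamma>0$, $\frac{\partial\Gamma}{\partial k_i}>0$, $\frac{\partial^2\Gamma}{\partial k_i^2}\le 0$ (and, without spillover, $\Gamma$ does not depend on $K_{-i}$). The functions $P,c,\gamma,\Gamma$ are common to all firms and as smooth as needed. Firm $i$ maximizes $\int_0^\infty e^{-\rho t}[p_iq_i-c(q_i)-\gamma(k_i)]\,dt$ with $\rho>0$. Its current value Hamiltonian is $$\hat{\mathcal H}_i=p_iq_i-c(q_i)-\gamma(k_i)+\lambda_{ii}(\Gamma_i-\delta A_i)+\sum_{j\ne i}\lambda_{ij}(\Gamma_j-\delta A_j).$$ First and second order conditions (no spillover; used in both solution concepts): $$p_i+\frac{\partial p_i}{\partial q_i}q_i-c'(q_i)=0,\qquad -\gamma'(k_i)+\lambda_{ii}\frac{\partial\Gamma_i}{\partial k_i}=0,$$ $$2\frac{\partial p_i}{\partial q_i}+\frac{\partial^2p_i}{\partial q_i^2}q_i-c''(q_i)<0,\qquad -\gamma''(k_i)+\lambda_{ii}\frac{\partial^2\Gamma_i}{\partial k_i^2}<0 .$$ Open-loop solution: these conditions together with the adjoint conditions, for all $i$ and $j\ne i$, $$-\frac{\partial\hat{\mathcal H}_i}{\partial A_i}=\frac{d\lambda_{ii}}{dt}-\rho\lambda_{ii},\qquad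 -\frac{\partial\hat{\mathcal H}_i}{\partial A_j}=\frac{d\lambda_{ij}}{dt}-\rho\lambda_{ij}.$$ Memoryless closed-loop solution: the same first and second order conditions together with the adjoint conditions $$-\frac{\partial\hat{\mathcal H}_i}{\partial A_i}-\sum_{j\ne i}\frac{\partial\hat{\mathcal H}_i}{\partial k_j}\frac{\partial k_j}{\partial A_i}-\sum_{j\ne i}\frac{\partial\hat{\mathcal H}_i}{\partial q_j}\frac{\partial q_j}{\partial A_i}=\frac{d\lambda_{ii}}{dt}-\rho\lambda_{ii},$$ $$-\frac{\partial\hat{\mathcal H}_i}{\partial A_j}-\sum_{l\ne i}\frac{\partial\hat{\mathcal H}_i}{\partial k_l}\frac{\partial k_l}{\partial A_j}-\sum_{l\ne i}\frac{\partial\hat{\mathcal H}_i}{\partial q_l}\frac{\partial q_l}{\partial A_j}=\frac{d\lambda_{ij}}{dt}-\rho\lambda_{ij}\quad(j\ne i).$$ Here $\frac{\partial k_j}{\partial A_i}=0$ for $j\neq i$ (the first order condition for $k_j$, given the costate, does not involve $A_i$), and $\frac{\partial q_j}{\partial A_i}$ is obtained by implicit differentiation, with respect to $A_i$, of the $n$ first order conditions for outputs at a symmetric state. That is, with $a=2\frac{\partial p_i}{\partial q_i}+\frac{\partial^2p_i}{\partial q_i^2}q_i-c''(q_i)$, $b=\frac{\partial p_j}{\partial q_i}+\frac{\partial^2p_j}{\partial q_i\partial q_j}q_j$ ($j\neq i$) and $\Psi=-\left[\frac{\partial p_i}{\partial A_i}+\frac{\partial^2p_i}{\partial q_i\partial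 A_i}q_i\right]<0$, $$a\frac{\partial q_i}{\partial A_i}+(n-1)b\frac{\partial q_j}{\partial A_i}=\Psi,\qquad b\frac{\partial q_i}{\partial A_i}+[a+(n-2)b]\frac{\partial q_j}{\partial A_i}=0,$$ and it is a standing assumption that the determinant $\Delta=a[a+(n-2)b]-(n-1)b^2$ is positive. Steady states: in each solution concept a steady state is a symmetric solution ($A_i,q_i,k_i$ and $\lambda_{ii}$ equal across firms, all $\lambda_{ij}$, $j\ne i$, equal) with $\frac{dA_i}{dt}=0$, $\frac{d\lambda_{ii}}{dt}=0$, $\frac{d\lambda_{ij}}{dt}=0$. For $A$ in the relevant open interval of states, let $q(A)$ be the unique common output satisfying the output first order condition when all $A_i=A$, and $k(A)$ the unique common investment with $\Gamma(k,(n-1)k)=\delta A$; both are differentiable in $A$. Each solution concept has a unique steady state in this interval, and it is a saddle point: with all entries evaluated at the symmetric state, the matrix $$\begin{bmatrix}-\delta & \dfrac{(\partial\Gamma_i/\partial k_i)^3}{\gamma''\,\partial\Gamma_i/\partial k_i-\gamma'\,\partial^2\Gamma_i/\partial k_i^2}\\ -\dfrac{d}{dA}F(A) & \rho+\delta\end{bmatrix}$$ has negative determinant at the steady state, where $F(A)=\frac{\partial p_i}{\partial A_i}q(A)$ for the open-loop solution and $F(A)=\left[\frac{\partial p_i}{\partial A_i}+(n-1)\frac{\partial p_i}{\partial q_j}\frac{\partial q_j}{\partial A_i}\right]q(A)$ for the closed-loop solution. *)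

(* Defs.v *)
From HB Require Import structures.
From mathcomp Require Import all_boot all_order all_algebra all_fingroup.
From mathcomp Require Import all_classical all_reals all_analysis.

Set Implicit Arguments.
Unset Strict Implicit.
Unset Printing Implicit Defensive.

Import Order.TTheory GRing.Theory Num.Theory.
Import numFieldNormedType.Exports.

Local Open Scope classical_set_scope.
Local Open Scope ring_scope.

(* [smooth_on k U f]: [f] is of class C^k on [U] (an open subset of a
   finite-dimensional [V] in all uses below).  Quantifying over all directions
   [v] amounts to quantifying over the partial derivatives. *)
Fixpoint smooth_on (R : realType) (V : normedModType R) (k : nat)
    (U : set V) (f : V -> R) : Prop :=
  match k with
  | 0 => forall x, U x -> {for x, continuous f}
  | k'.+1 => (forall x, U x -> differentiable f x) /\
             (forall v, smooth_on k' U ('D_v f))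
  end.

(* [inv_demand a x y] is P(A_i, q_i, (q_j)_{j <> i}); [accum k K] is
   Gamma(k_i, K_{-i}). *)
Record oligopoly (R : realType) (n : nat) := Oligopoly {
  inv_demand : R -> R -> 'rV[R]_n.-1 -> R;
  prod_cost : R -> R;
  adv_cost : R -> R;
  accum : R -> R -> R;
  decay : R;
  discount : R
}.

Section PartialDerivatives.
Variables (R : realType) (n : nat).
Implicit Types (f : 'rV[R]_n -> 'rV[R]_n -> R) (i : 'I_n) (A q : 'rV[R]_n).

Definition unit_row i : 'rV[R]_n := delta_mx 0 i.

(* For [f] a function of the profiles (A, q): the functions df/dA_i, df/dq_i. *)
Definition dA i f : 'rV[R]_n -> 'rV[R]_n -> R :=
  fun A q => 'D_(unit_row i) (fun A' => f A' q) A.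

Definition dq i f : 'rV[R]_n -> 'rV[R]_n -> R :=
  fun A q => 'D_(unit_row i) (fun q' => f A q') q.

End PartialDerivatives.

Section Model.
Variables (R : realType) (n : nat) (M : oligopoly R n).
Implicit Types (i j l : 'I_n) (A q k : 'rV[R]_n) (mu : 'M[R]_n).

Definition price i A q : R := inv_demand M (A 0 i) (q 0 i) (col' i q).

Definition rivals_investment i k : R := \sum_(j | j != i) k 0 j.

Definition accum_of i k : R := accum M (k 0 i) (rivals_investment i k).

Definition accum_k (x K : R) : R := derive1 (fun x' => accum M x' K) x.
Definition accum_kk (x K : R) : R := derive1n 2 (fun x' => accum M x' K) x.

(* Left-hand side of the first order condition for q_i. *)
Definition output_foc i A q : R :=
  price i A q + dq i (price i) A q * q 0 i - derive1 (prod_cost M) (q 0 i).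

(* Derivatives of the first order conditions: d foc_i/dq_i, d foc_j/dq_i for
   j <> i, and -d foc_i/dA_i.  [Delta] is the determinant of the linear system
   [symmetric_output_response]. *)
Definition own_slope i A q : R :=
  2 * dq i (price i) A q + dq i (dq i (price i)) A q * q 0 i
  - derive1n 2 (prod_cost M) (q 0 i).

Definition cross_slope i j A q : R :=
  dq i (price j) A q + dq i (dq j (price j)) A q * q 0 j.

Definition Psi i A q : R :=
  - (dA i (price i) A q + dA i (dq i (price i)) A q * q 0 i).

Definition Delta i j A q : R :=
  own_slope i A q * (own_slope i A q + (n - 2)%:R * cross_slope i j A q)
  - (n - 1)%:R * cross_slope i j A q ^+ 2.

Section Assumptions.
Variable I : set R.

Definition positive_profile q : Prop := forall i, 0 < q 0 i.

Definition admissible A q : Prop := (forall i, I (A 0 i)) /\ positive_profile q.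

(* [I] is the open interval of states; the conditions on demand are only
   required there. *)
Record model_assumptions : Prop := ModelAssumptions {
  decay_gt0 : 0 < decay M;
  discount_gt0 : 0 < discount M;
  interval_states : is_interval I;
  open_states : open I;
  demand_smooth :
    smooth_on 3 [set z : R * R * 'rV[R]_n.-1 |
                  [/\ I z.1.1, 0 < z.1.2 & forall m, 0 < z.2 0 m]]
              (fun z => inv_demand M z.1.1 z.1.2 z.2);
  demand_sym : forall (s : 'S_n.-1) (a x : R) (y : 'rV[R]_n.-1),
    I a -> 0 < x -> (forall m, 0 < y 0 m) ->
    inv_demand M a x (col_perm s y) = inv_demand M a x y;
  dp_own_lt0 : forall i A q, admissible A q -> dq i (price i) A q < 0;
  dp_cross_lt0 : forall i j A q, admissible A q -> j != i ->
    dq j (price i) A q < 0;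
  dp_state_gt0 : forall i A q, admissible A q -> 0 < dA i (price i) A q;
  dp_state_output_gt0 : forall i A q, admissible A q ->
    0 < dA i (price i) A q + dA i (dq i (price i)) A q * q 0 i;
  prod_cost_smooth : smooth_on 3 [set x : R | 0 < x] (prod_cost M);
  prod_cost_gt0 : forall x : R, 0 < x -> 0 < prod_cost M x;
  prod_cost'_gt0 : forall x : R, 0 < x -> 0 < derive1 (prod_cost M) x;
  prod_cost''_ge0 : forall x : R, 0 < x -> 0 <= derive1n 2 (prod_cost M) x;
  adv_cost_smooth : smooth_on 3 [set x : R | 0 < x] (adv_cost M);
  adv_cost_gt0 : forall x : R, 0 < x -> 0 < adv_cost M x;
  adv_cost'_gt0 : forall x : R, 0 < x -> 0 < derive1 (adv_cost M) x;
  adv_cost''_gt0 : forall x : R, 0 < x -> 0 < derive1n 2 (adv_cost M) x;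
  accum_smooth : smooth_on 3 [set z : R * R | 0 < z.1 /\ 0 < z.2]
                           (fun z => accum M z.1 z.2);
  accum_gt0 : forall x K : R, 0 < x -> 0 < K -> 0 < accum M x K;
  accum_k_gt0 : forall x K : R, 0 < x -> 0 < K -> 0 < accum_k x K;
  accum_kk_le0 : forall x K : R, 0 < x -> 0 < K -> accum_kk x K <= 0
}.

Definition no_spillover : Prop :=
  forall x K : R, 0 < x -> 0 < K -> derive1 (fun K' => accum M x K') K = 0.

Definition strategic_substitutes : Prop :=
  forall i j A q, admissible A q -> j != i -> cross_slope i j A q < 0.

Definition strategic_complements : Prop :=
  forall i j A q, admissible A q -> j != i -> 0 < cross_slope i j A q.

End Assumptions.

(* Current value Hamiltonian of Firm i; [mu i j] is lambda_ij. *)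
Definition hamiltonian i A q k mu : R :=
  price i A q * q 0 i - prod_cost M (q 0 i) - adv_cost M (k 0 i)
  + mu i i * (accum_of i k - decay M * A 0 i)
  + \sum_(j | j != i) mu i j * (accum_of j k - decay M * A 0 j).

Definition dH_dA i j A q k mu : R :=
  dA j (fun A' q' => hamiltonian i A' q' k mu) A q.
Definition dH_dq i j A q k mu : R :=
  dq j (fun A' q' => hamiltonian i A' q' k mu) A q.
Definition dH_dk i j A q k mu : R :=
  'D_(unit_row R j) (fun k' => hamiltonian i A q k' mu) k.

Definition first_order A q k mu : Prop :=
  forall i, output_foc i A q = 0 /\
    - derive1 (adv_cost M) (k 0 i)
      + mu i i * accum_k (k 0 i) (rivals_investment i k) = 0.

Definition second_order A q k mu : Prop :=
  forall i, own_slope i A q < 0 /\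
    - derive1n 2 (adv_cost M) (k 0 i)
      + mu i i * accum_kk (k 0 i) (rivals_investment i k) < 0.

(* [D l j] stands for dq_l/dA_j: the n output first order conditions,
   differentiated with respect to A_j with q a function of A.  At a symmetric
   profile, column j of this linear system reduces to the 2 x 2 system
   [symmetric_output_response] below. *)
Definition output_response A q (D : 'M[R]_n) : Prop :=
  forall j i, dA j (output_foc i) A q
              + \sum_l dq l (output_foc i) A q * D l j = 0.

(* dk_l/dA_j: given the costate, the first order condition for k_l involves
   no A_j. *)
Definition dk_dA (l j : 'I_n) : R := 0.

(* Values of d lambda_ij/dt prescribed by the adjoint conditions; the cases
   j = i and j <> i have the same form. *)
Definition open_loop_adjoint i j A q k mu : R :=
  discount M * mu i j - dH_dA i j A q k mu.

Definition closed_loop_adjoint (D : 'M[R]_n) i j A q k mu : R :=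
  discount M * mu i j - dH_dA i j A q k mu
  - \sum_(l | l != i) dH_dk i l A q k mu * dk_dA l j
  - \sum_(l | l != i) dH_dq i l A q k mu * D l j.

Record path := Path {
  state : R -> 'rV[R]_n;
  output : R -> 'rV[R]_n;
  invest : R -> 'rV[R]_n;
  costate : R -> 'M[R]_n
}.

(* Time runs over [0, +oo[; the differential equations are required at t > 0,
   with continuity up to t = 0. *)
Definition common_conditions (x : path) : Prop :=
  [/\ forall t : R, 0 <= t ->
        [/\ positive_profile (output x t), positive_profile (invest x t),
            first_order (state x t) (output x t) (invest x t) (costate x t) &
            second_order (state x t) (output x t) (invest x t) (costate x t)],
      forall i, {within [set t : R | 0 <= t], continuous (fun t : R => state x t 0 i)},
      forall i j,
        {within [set t : R | 0 <= t], continuous (fun t : R => costate x t i j)} &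
      forall t : R, 0 < t -> forall i,
        is_derive t 1 (fun s => state x s 0 i)
          (accum_of i (invest x t) - decay M * state x t 0 i)].

Definition open_loop_solution (x : path) : Prop :=
  common_conditions x /\
  forall t : R, 0 < t -> forall i j,
    is_derive t 1 (fun s => costate x s i j)
      (open_loop_adjoint i j
         (state x t) (output x t) (invest x t) (costate x t)).

Definition closed_loop_solution (x : path) : Prop :=
  common_conditions x /\
  forall t : R, 0 < t -> exists2 D : 'M[R]_n,
    output_response (state x t) (output x t) D &
    forall i j,
      is_derive t 1 (fun s => costate x s i j)
        (closed_loop_adjoint D i j
           (state x t) (output x t) (invest x t) (costate x t)).

Definition symmetric_path (x : path) : Prop :=
  forall t : R, 0 <= t ->
    [/\ forall i j, state x t 0 i = state x t 0 j,
        forall i j, output x t 0 i = output x t 0 j,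
        forall i j, invest x t 0 i = invest x t 0 j,
        forall i j, costate x t i i = costate x t j j &
        forall i j i' j', j != i -> j' != i' ->
          costate x t i j = costate x t i' j'].

(* [a] is the value of A_i(t) at some steady state of the concept [sol]. *)
Definition steady_state_value (sol : path -> Prop) (a : R) : Prop :=
  exists x : path,
    [/\ sol x, symmetric_path x,
        forall t : R, 0 < t ->
          (forall i, is_derive t 1 (fun s => state x s 0 i) (0 : R)) /\
          (forall i j, is_derive t 1 (fun s => costate x s i j) (0 : R)) &
        forall (t : R) i, 0 <= t -> state x t 0 i = a].

Definition unique_steady_state_value (I : set R) (sol : path -> Prop) (a : R) :
    Prop :=
  [/\ I a, steady_state_value sol a &
      forall a', I a' -> steady_state_value sol a' -> a' = a].

Section SymmetricStates.
Variables (I : set R) (qs ks : R -> R).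

Definition symA (a : R) : 'rV[R]_n := const_mx a.
Definition symq (a : R) : 'rV[R]_n := const_mx (qs a).

Definition symmetric_output : Prop :=
  forall a, I a ->
    [/\ 0 < qs a, forall i, output_foc i (symA a) (symq a) = 0,
        forall x : R, 0 < x ->
          (forall i, output_foc i (symA a) (const_mx x) = 0) -> x = qs a &
        derivable qs a 1].

Definition symmetric_investment : Prop :=
  forall a, I a ->
    [/\ 0 < ks a, accum M (ks a) ((n - 1)%:R * ks a) = decay M * a,
        forall x : R, 0 < x -> accum M x ((n - 1)%:R * x) = decay M * a ->
          x = ks a &
        derivable ks a 1].

(* [own a] and [cross a] are dq_i/dA_i and dq_j/dA_i (j <> i) at the symmetric
   state. *)
Definition symmetric_output_response (own cross : R -> R) : Prop :=
  forall a, I a -> forall i j, j != i ->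
    own_slope i (symA a) (symq a) * own a
      + (n - 1)%:R * cross_slope i j (symA a) (symq a) * cross a
      = Psi i (symA a) (symq a) /\
    cross_slope i j (symA a) (symq a) * own a
      + (own_slope i (symA a) (symq a)
         + (n - 2)%:R * cross_slope i j (symA a) (symq a)) * cross a
      = 0.

Definition F_open i (a : R) : R := dA i (price i) (symA a) (symq a) * qs a.

Definition F_closed (cross : R -> R) i j (a : R) : R :=
  (dA i (price i) (symA a) (symq a)
   + (n - 1)%:R * dq j (price i) (symA a) (symq a) * cross a) * qs a.

Definition steady_state_matrix (F : R -> R) (a : R) : 'M[R]_2 :=
  let k := ks a in
  let K := (n - 1)%:R * ks a in
  let entries :=
    [:: [:: - decay M;
            accum_k k K ^+ 3 / (derive1n 2 (adv_cost M) k * accum_k k K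
                                - derive1 (adv_cost M) k * accum_kk k K)];
        [:: - derive1 F a; discount M + decay M]] in
  \matrix_(r < 2, s < 2) (nth [::] entries r)`_s.

Definition saddle (F : R -> R) (a : R) : Prop :=
  \det (steady_state_matrix F a) < 0.

End SymmetricStates.

End Model.

(* Main.v *)
Require Import Defs.
From HB Require Import structures.
From mathcomp Require Import all_boot all_order all_algebra all_fingroup.
From mathcomp Require Import all_classical all_reals all_analysis.
From mathcomp Require Import ring lra.
Import Order.TTheory GRing.Theory Num.Theory.
Import numFieldNormedType.Exports.
Local Open Scope classical_set_scope.
Local Open Scope ring_scope.

(* At a symmetric state a the conditions on investment fix the costate
   lambda_ii, and the open-loop adjoint equation becomes F_open a = G a, where
   G a = (rho + delta) gamma'(k a) / Gamma_k(k a).  The own slope never vanishes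
   because Delta > 0, so it is negative on all of I once it is so at one steady
   state; hence every root in I carries an open-loop steady state, and
   uniqueness makes Aol the only zero of h = F_open - G on I.  The saddle
   condition says that h' is negative at Aol, whence h > 0 below Aol and h < 0
   above.  The closed-loop adjoint equation has the extra term
   sum_(l != i) (dp_i/dq_l) q (dq_l/dA_i), with dq_l/dA_i = - b Psi / Delta of
   the sign of b, so h(Acl) < 0 for strategic substitutes and h(Acl) > 0 for
   strategic complements. *)

Set Implicit Arguments.
Unset Strict Implicit.
Unset Printing Implicit Defensive.

(** * Sign changes of continuous functions on an interval *)

Lemma continuous_sign_change_zero (R : realType) (I : set R) (f : R -> R)
    (x y : R) :
  is_interval I -> (forall z, I z -> {for z, continuous f}) ->
  I x -> I y -> x <= y -> f x * f y <= 0 ->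
  exists2 c, x <= c <= y & f c = 0.
Proof.
move=> itvI cf Ix Iy xy fxy.
have [||c] := @IVT R f x y 0 xy.
- apply: continuous_in_subspaceT => z /[!inE] /= zxy.
  by apply: cf; apply: (itvI x y) => //; rewrite in_itv /= in zxy.
- rewrite ge_min le_max.
  by case: (ltP (f x) 0); case: (ltP (f y) 0) => /=; nra.
by rewrite in_itv /=; exists c.
Qed.

(** A change of sign would produce a zero between [x] and [y], which lies in the interval. Used to
    carry the sign of the own slope from one state to all of [I]. *)
Lemma continuous_nonvanishing_lt0 (R : realType) (I : set R) (f : R -> R)
    (x y : R) :
  is_interval I -> (forall z, I z -> {for z, continuous f}) ->
  (forall z, I z -> f z != 0) -> I x -> I y -> f x < 0 -> f y < 0.
Proof.
move=> itvI cf f0 Ix Iy fx; rewrite ltNge; apply/negP => fy.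
have zero u v : I u -> I v -> u <= v -> f u * f v <= 0 -> False.
  move=> Iu Iv uv fuv.
  have [c cuv fc] := continuous_sign_change_zero itvI cf Iu Iv uv fuv.
  by have := f0 c (itvI _ _ Iu Iv _ cuv); rewrite fc eqxx.
have [xy|yx] := leP x y; first by apply: (zero x y) => //; nra.
by apply: (zero y x) => //; [exact: ltW|nra].
Qed.

(** Near [x] the difference quotient is negative; multiplying it by [h ^+ 2] removes the division
    and treats both sides of [x] at once. *)
Lemma derive1_lt0_nbhs (R : realType) (f : R -> R) (x : R) :
  derivable f x 1 -> derive1 f x < 0 ->
  exists2 e : R, 0 < e &
    forall h, h != 0 -> `|h| < e -> h * (f (h + x) - f x) < 0.
Proof.
rewrite derive1E => df f'x.
have /(_ _ _ f'x) := (@cvgr_lt _ _ _ _ _ _ df).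
move=> [e /= e0 He]; exists e => // h h0 he.
have := He h; rewrite /= sub0r normrN => /(_ he h0).
rewrite -[_ *: 1]/(h * 1) mulr1 -[_ *: (_ - _)]/(_ * _) => H.
have : h ^+ 2 * (h^-1 * (f (h + x) - f x)) < 0.
  by rewrite pmulr_rlt0 // exprn_even_gt0.
by rewrite mulrA expr2 mulfK.
Qed.

(** Next to [x0] the derivative makes [f] positive on the left and negative on the right. A value of
    the wrong sign farther away on either side would force a second zero there. *)
Lemma downward_crossing (R : realType) (I : set R) (f : R -> R) (x0 : R) :
  is_interval I -> (forall z, I z -> {for z, continuous f}) -> I x0 ->
  f x0 = 0 -> (forall z, I z -> f z = 0 -> z = x0) ->
  derivable f x0 1 -> derive1 f x0 < 0 ->
  forall x, I x -> (f x < 0 -> x0 < x) /\ (0 < f x -> x < x0).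
Proof.
move=> itvI cf I0 f0 uniq df f'0 x Ix.
have [e e0 He] := derive1_lt0_nbhs df f'0.
split=> fx; rewrite ltNge le_eqVlt; apply/negP => /orP[/eqP xx0|xx0].
- by move: fx; rewrite xx0 f0 ltxx.
(* The halves place [x0 - h] within the radius [e] and strictly between [x] and [x0], so that a zero
   in [[x, x0 - h]] differs from [x0]. *)
- pose h := Num.min (e / 2) ((x0 - x) / 2).
  have [h0 he hx] : [/\ 0 < h, h < e & h < x0 - x].
    by split; rewrite ?lt_min ?gt_min; lra.
  have := He (- h).
  rewrite normrN gtr0_norm // oppr_eq0 gt_eqF // => /(_ isT he).
  rewrite f0 subr0 => fh.
  have xh : x <= - h + x0 by lra.
  have Ih : I (- h + x0) by apply: (itvI x x0) => //; lra.
  have [|c /andP[xc ch] fc] := continuous_sign_change_zero itvI cf Ix Ih xh.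
    by nra.
  have := uniq c; rewrite fc => /(_ _ erefl) cx0.
  have : c = x0 by apply: cx0; apply: (itvI x x0) => //; lra.
  lra.
- by move: fx; rewrite -xx0 f0 ltxx.
- pose h := Num.min (e / 2) ((x - x0) / 2).
  have [h0 he hx] : [/\ 0 < h, h < e & h < x - x0].
    by split; rewrite ?lt_min ?gt_min; lra.
  have := He h; rewrite gtr0_norm // gt_eqF // => /(_ isT he).
  rewrite f0 subr0 => fh.
  have xh : h + x0 <= x by lra.
  have Ih : I (h + x0) by apply: (itvI x0 x) => //; lra.
  have [|c /andP[xc ch] fc] := continuous_sign_change_zero itvI cf Ih Ix xh.
    by nra.
  have := uniq c; rewrite fc => /(_ _ erefl) cx0.
  have : c = x0 by apply: cx0; apply: (itvI x0 x) => //; lra.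
  lra.
Qed.

(** * Directional derivatives compared along lines *)

Lemma derive_affine (R : realType) (V W : normedModType R)
    (f : V -> R) (g : W -> R) (v a : V) (w b : W) (c d : R) :
  derivable g b w ->
  (forall h : R, f (h *: v + a) - f a = c * (g (h *: w + b) - g b) + h * d) ->
  'D_v f a = c * 'D_w g b + d.
Proof.
move=> dg fg; apply/cvg_lim => //.
have gc : (fun h : R => c * (h^-1 *: ((g \o shift b) (h *: w) - g b)) + d)
    @ 0^' --> c * 'D_w g b + d.
  by apply: cvgD; [apply: cvgMr => //; exact: dg|exact: cvg_cst].
apply: cvg_trans gc; apply: near_eq_cvg; near=> h.
have h0 : h != 0 by near: h; exact: nbhs_dnbhs_neq.
rewrite /= fg -!/(_ * _) /GRing.scale /=; field.
exact: h0.
Unshelve. all: by end_near. Qed.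

(** A directional derivative depends only on the restriction to one line. This trades derivatives on
    profiles for derivatives on a smaller space. *)
Lemma derive_eq_along (R : realType) (V W : normedModType R)
    (f : V -> R) (g : W -> R) (v a : V) (w b : W) :
  (forall h : R, f (h *: v + a) = g (h *: w + b)) -> 'D_v f a = 'D_w g b.
Proof.
move=> fg; have := fg 0; rewrite !scale0r !add0r => fgab.
rewrite /derive; set F := (F in F @ _); set G := (G in _ = lim (G @ _)).
by rewrite (_ : F = G) //; apply/funext => h; rewrite /F /G /= fg fgab.
Qed.

(** The linear map [s] sends lines to lines, so the left side is the derivative of [f \o s] at [a]
    along [v], and [f \o s] agrees with [f] near [a]. *)
Lemma derive_invariant (R : realType) (V : normedModType R) (U : set V)
    (f : V -> R) (s : V -> V) (v a : V) :
  open U -> (forall (h : R) x y, s (h *: x + y) = h *: s x + s y) ->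
  (forall x, U x -> f (s x) = f x) -> U a -> 'D_(s v) f (s a) = 'D_v f a.
Proof.
move=> oU slin sf Ua.
rewrite (@derive_eq_along _ _ _ _ (f \o s) (s v) (s a) v a).
  apply: near_eq_derive; near=> x; apply: sf; near: x.
  exact: (open_nbhs_nbhs (conj oU Ua)).
by move=> h /=; rewrite slin.
Unshelve. all: by end_near. Qed.

Lemma smooth_on_differentiable (R : realType) (V : normedModType R) k
    (U : set V) (f : V -> R) x :
  smooth_on k.+1 U f -> U x -> differentiable f x.
Proof. by case=> + _; exact. Qed.

Lemma smooth_onS_derive1 (R : realType) k (U : set R) (f : R -> R) :
  smooth_on k.+1 U f -> smooth_on k U (derive1 f).
Proof.
case=> _ /(_ 1); congr smooth_on; apply/funext => x; by rewrite derive1E.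
Qed.

Lemma derivable_derive0_eq (R : realType) (f : R -> R) (x y : R) :
  (forall z, 0 < z -> derivable f z 1) ->
  (forall z, 0 < z -> derive1 f z = 0) ->
  0 < x -> 0 < y -> f x = f y.
Proof.
move=> df f'0.
wlog xy : x y / x <= y => [wl|] x0 y0.
  by have [/wl->|/ltW /wl <-] := leP x y.
have pos z : z \in `[x, y] -> 0 < z.
  by rewrite in_itv /= => /andP[xz _]; exact: lt_le_trans xz.
have [||z zxy fz] := @MVT_segment R f (derive1 f) x y xy.
- move=> z /[!in_itv] /= /andP[xz _].
  by apply: DeriveDef; [apply: df; exact: lt_trans xz|rewrite derive1E].
- by apply: derivable_within_continuous => z /pos /df.
- by apply/esym/eqP; rewrite -subr_eq0 fz f'0 ?mul0r // pos.
Qed.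

Lemma smooth_on_derive (R : realType) (V : normedModType R) k (U : set V)
    (f : V -> R) v :
  smooth_on k.+1 U f -> smooth_on k U ('D_v f).
Proof. by case=> _; exact. Qed.

Lemma is_derive1P (R : realType) (f : R -> R) (x : R) :
  derivable f x 1 -> is_derive x 1 f (derive1 f x).
Proof. by move=> df; apply: DeriveDef; [exact: df|rewrite derive1E]. Qed.

(** * Accumulation without spillover and the steady costate *)

Section Investment.
Variables (R : realType) (n : nat) (M : oligopoly R n) (I : set R).
Hypotheses (hM : model_assumptions M I) (nsp : no_spillover M).

Lemma accum_no_spillover (x K : R) :
  0 < x -> 0 < K -> accum M x K = accum M x 1.
Proof.
move=> x0 K0.
apply: (@derivable_derive0_eq _ (accum M x)) => // z z0; last exact: nsp.
apply/derivable1_diffP.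
apply: (@differentiable_comp _ _ _ _ (fun K' => (x, K'))
  (fun z => accum M z.1 z.2)); first exact: differentiable_pair.
exact: (smooth_on_differentiable (accum_smooth hM)).
Qed.

(** By [accum_no_spillover], Gamma as a function of own investment; 1 is an arbitrary positive value
    of K. *)
Definition accum1 (x : R) : R := accum M x 1.

Lemma derive1_accum1 :
  derive1 accum1 =
  (fun x => 'D_((1, 0) : R * R) (fun z => accum M z.1 z.2) (x, 1)).
Proof.
apply/funext => x; rewrite derive1E; apply: derive_eq_along => h /=.
by congr (accum M _ _); rewrite scaler0 add0r.
Qed.

Lemma derivable_accum1 (x : R) : 0 < x -> derivable accum1 x 1.
Proof.
move=> x0; apply/derivable1_diffP.
apply: (@differentiable_comp _ _ _ _ (fun y : R => (y, 1 : R))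
  (fun z => accum M z.1 z.2)); first exact: differentiable_pair.
exact: (smooth_on_differentiable (accum_smooth hM)).
Qed.

Lemma derivable_derive1_accum1 (x : R) :
  0 < x -> derivable (derive1 accum1) x 1.
Proof.
move=> x0; rewrite derive1_accum1; apply/derivable1_diffP.
apply: (@differentiable_comp _ _ _ _ (fun y : R => (y, 1 : R))
  ('D_((1, 0) : R * R) (fun z => accum M z.1 z.2)));
  first exact: differentiable_pair.
apply: (smooth_on_differentiable
  (smooth_on_derive ((1, 0) : (R * R)%type) (accum_smooth hM))).
by split => /=.
Qed.

Lemma accum_kE (x K : R) : 0 < x -> 0 < K -> accum_k M x K = derive1 accum1 x.
Proof.
move=> x0 K0; rewrite /accum_k !derive1E; apply: near_eq_derive.
near=> y; apply: accum_no_spillover => //; near: y.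
exact: lt_nbhsr.
Unshelve. all: by end_near. Qed.

Lemma accum_kkE (x K : R) :
  0 < x -> 0 < K -> accum_kk M x K = derive1 (derive1 accum1) x.
Proof.
move=> x0 K0; rewrite /accum_kk /= !derive1E; apply: near_eq_derive.
near=> y; apply: accum_kE => //; near: y.
exact: lt_nbhsr.
Unshelve. all: by end_near. Qed.

(** The value of lambda_ii that solves the first order condition for investment. *)
Definition steady_costate (x : R) : R :=
  derive1 (adv_cost M) x / derive1 accum1 x.

(* At a symmetric state, the conditions on [(k, lambda_ii)] amount to
   [F a = adjoint_level a]. *)
Definition adjoint_level (ks : R -> R) (a : R) : R :=
  (discount M + decay M) * steady_costate (ks a).

Variable ks : R -> R.
Hypotheses (n_ge2 : (2 <= n)%N) (hks : symmetric_investment M I ks).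

Lemma rivals_gt0 (x : R) : 0 < x -> 0 < (n - 1)%:R * x.
Proof. by move=> x0; rewrite mulr_gt0 // ltr0n subn_gt0. Qed.

(** Implicit differentiation of [accum1 (ks b) = decay M * b], valid for [b] near [a] because [I] is
    open. *)
Lemma derive1_accum1_ks (a : R) :
  I a -> derive1 accum1 (ks a) * derive1 ks a = decay M.
Proof.
move=> Ia; have [k0 _ _ dk] := hks Ia.
have [_ <-] := @is_derive1_comp _ accum1 ks _ _ _
  (is_derive1P (derivable_accum1 k0)) (is_derive1P dk).
have <- : 'D_1 (decay M \*: id) a = decay M.
  by have [_ ->] := is_deriveZ (decay M) (is_derive_id a (1 : R)); exact: mulr1.
apply: near_eq_derive; near=> b.
have Ib : I b by near: b; exact: (open_nbhs_nbhs (conj (open_states hM) Ia)).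
have [kb0 e _ _] := hks Ib.
by rewrite -[RHS]/(decay M * b) -e (accum_no_spillover kb0 (rivals_gt0 kb0)).
Unshelve. all: by end_near. Qed.

(** The quotient rule for gamma' / Gamma_k is combined with k' = delta / Gamma_k. The denominator is
    kept as the upper right entry of [steady_state_matrix], ready for the saddle condition. *)
Lemma is_derive_adjoint_level (a : R) :
  let k := ks a in
  let K := (n - 1)%:R * ks a in
  I a ->
  is_derive a 1 (adjoint_level ks)
    (decay M * (discount M + decay M) /
     (accum_k M k K ^+ 3 / (derive1n 2 (adv_cost M) k * accum_k M k K
                            - derive1 (adv_cost M) k * accum_kk M k K))).
Proof.
move=> k K Ia; have [k0 _ _ dk] := hks Ia.
have K0 : 0 < K by exact: rivals_gt0.
have kk := derive1_accum1_ks Ia.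
have gk0 := accum_k_gt0 hM k0 K0; have gkk0 := accum_kk_le0 hM k0 K0.
have c1 := adv_cost'_gt0 hM k0; have c2 := adv_cost''_gt0 hM k0.
rewrite -/k in k0 gk0 gkk0 c1 c2 kk.
rewrite (accum_kE k0 K0) (accum_kkE k0 K0) in gk0 gkk0 *.
have dg' := derivable_derive1_accum1 k0.
have dc' : derivable (derive1 (adv_cost M)) k 1.
  apply/derivable1_diffP.
  exact: (smooth_on_differentiable (smooth_onS_derive1 (adv_cost_smooth hM))).
have dV := is_deriveV (lt0r_neq0 gk0) (is_derive1P dg').
have dsc := @is_derive1_comp _ steady_costate ks _ _ _
  (is_deriveM (is_derive1P dc') dV) (is_derive1P dk).
have dG : is_derive a 1 (adjoint_level ks) _ :=
  is_deriveZ (discount M + decay M) dsc.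
apply: is_derive_eq dG _.
(* With delta written as Gamma_k k', the goal is an identity of rational functions. *)
rewrite -kk.
rewrite -[derive1n 2 _ k]/(derive1 (derive1 (adv_cost M)) k) in c2 *.
rewrite /GRing.scale /= => {dsc dV dg' dc' kk}.
move: (derive1 accum1 k) (derive1 (derive1 accum1) k) (derive1 ks a) gk0 gkk0
  => g g' k'.
move: (derive1 _ k) (derive1 _ k) (discount M) c1 c2 => c' c'' rho c1 c2 g0 g'0.
field; apply/andP; split; last exact: lt0r_neq0.
by apply: lt0r_neq0; nra.
Qed.

End Investment.

(** * Prices seen through one firm's view of the profile *)

Section Demand.
Variables (R : realType) (n : nat) (M : oligopoly R n) (I : set R).
Implicit Types (A q u v : 'rV[R]_n) (i j l : 'I_n).
Local Notation view_t := (R * R * 'rV[R]_n.-1)%type.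

(* Firm [i]'s inverse demand sees the profile [(A, q)] only through the linear
   map [view i], so that the partial derivatives of prices are directional
   derivatives of the common function [demand]. *)
Definition demand (z : view_t) : R := inv_demand M z.1.1 z.1.2 z.2.

Definition view i A q : view_t := (A 0 i, q 0 i, col' i q).

Definition dir_state : view_t := (1, 0, 0).
Definition dir_own : view_t := (0, 1, 0).
Definition dir_rival (m : 'I_n.-1) : view_t := (0, 0, delta_mx 0 m).

Lemma view_linear i (h : R) u v A q :
  view i (h *: u + A) (h *: v + q) = h *: view i u v + view i A q.
Proof.
by congr (_, _, _); rewrite ?mxE //; apply/rowP => m; rewrite !mxE.
Qed.

Lemma view_unit_state i : view i (unit_row R i) 0 = dir_state.
Proof.
congr (_, _, _); rewrite ?mxE ?eqxx //.
by apply/rowP => m; rewrite !mxE.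
Qed.

Lemma view_unit_state_neq i j : j != i -> view i (unit_row R j) 0 = 0.
Proof.
move=> ji; congr (_, _, _); rewrite ?mxE ?eqxx //= 1?eq_sym ?(negPf ji) //.
by apply/rowP => m; rewrite !mxE.
Qed.

Lemma view_unit_output i : view i 0 (unit_row R i) = dir_own.
Proof.
congr (_, _, _); rewrite ?mxE ?eqxx //.
by apply/rowP => m; rewrite !mxE eqxx /= eq_sym (negPf (neq_lift _ _)).
Qed.

Lemma view_unit_output_lift i m :
  view i 0 (unit_row R (lift i m)) = dir_rival m.
Proof.
congr (_, _, _); rewrite ?mxE ?eqxx //= ?(negPf (neq_lift _ _)) //.
by apply/rowP => m'; rewrite !mxE eqxx /= (inj_eq lift_inj).
Qed.

Lemma dA_view i j (f : view_t -> R) A q :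
  dA j (fun A' q' => f (view i A' q')) A q =
  'D_(view i (unit_row R j) 0) f (view i A q).
Proof.
apply: derive_eq_along => h; congr (f _).
by rewrite -view_linear scaler0 add0r.
Qed.

Lemma dq_view i j (f : view_t -> R) A q :
  dq j (fun A' q' => f (view i A' q')) A q =
  'D_(view i 0 (unit_row R j)) f (view i A q).
Proof.
apply: derive_eq_along => h; congr (f _).
by rewrite -view_linear scaler0 add0r.
Qed.

Lemma dA_price i A q :
  dA i (price M i) A q = 'D_dir_state demand (view i A q).
Proof.
by rewrite -[price M i]/(fun A' q' => demand (view i A' q')) dA_view
  view_unit_state.
Qed.

Lemma dA_price_neq i j A q : j != i -> dA j (price M i) A q = 0.
Proof.
move=> ji; rewrite -[price M i]/(fun A' q' => demand (view i A' q')) dA_view.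
by rewrite view_unit_state_neq // derive0.
Qed.

Lemma dq_price i :
  dq i (price M i) = fun A q => 'D_dir_own demand (view i A q).
Proof.
apply/funext => A; apply/funext => q.
by rewrite -[price M i]/(fun A' q' => demand (view i A' q')) dq_view
  view_unit_output.
Qed.

Lemma dq_price_lift i m A q :
  dq (lift i m) (price M i) A q = 'D_(dir_rival m) demand (view i A q).
Proof.
by rewrite -[price M i]/(fun A' q' => demand (view i A' q')) dq_view
  view_unit_output_lift.
Qed.

(** One function on views serves all firms: the derivatives of [output_foc] in any A_j or q_j are
    its directional derivatives. *)
Definition foc (z : view_t) : R :=
  demand z + 'D_dir_own demand z * z.1.2 - derive1 (prod_cost M) z.1.2.

Lemma output_foc_view i :
  output_foc M i = fun A q => foc (view i A q).
Proof.
by apply/funext => A; apply/funext => q; rewrite /output_foc dq_price.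
Qed.

Hypothesis hM : model_assumptions M I.

Definition view_dom : set view_t :=
  [set z : view_t | [/\ I z.1.1, 0 < z.1.2 & forall m, 0 < z.2 0 m]].

Lemma view_dom_open : open view_dom.
Proof.
have c1 : continuous (fun z : view_t => z.1.1).
  by move=> z; apply: cvg_comp; [exact: cvg_fst|exact: cvg_fst].
have c2 : continuous (fun z : view_t => z.1.2).
  by move=> z; apply: cvg_comp; [exact: cvg_fst|exact: cvg_snd].
have c3 m : continuous (fun z : view_t => z.2 0 m).
  move=> z; apply: (@cvg_comp _ _ _ snd (fun y : 'rV[R]_n.-1 => y 0 m)).
    exact: cvg_snd.
  exact: coord_continuous.
rewrite openE => z [z1 z2 z3]; rewrite /interior.
near=> y; split; last (move=> m; move: m; near: y; apply: filter_forall => m).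
- by near: y; exact: (c1 z _ (open_nbhs_nbhs (conj (open_states hM) z1))).
- by near: y; exact: (c2 z _ (lt_nbhsr z2)).
- exact: (c3 m z _ (lt_nbhsr (z3 m))).
Unshelve. all: by end_near. Qed.

Definition sym_view (a x : R) : view_t := (a, x, const_mx x).

Lemma view_sym i (a x : R) : view i (const_mx a) (const_mx x) = sym_view a x.
Proof. by rewrite /view !mxE; congr (_, _); apply/rowP => m; rewrite !mxE. Qed.

Lemma sym_view_dom (a x : R) : I a -> 0 < x -> view_dom (sym_view a x).
Proof. by move=> Ia x0; split=> //= m; rewrite mxE. Qed.

End Demand.

(** * Derivatives of demand and of the output condition; symmetry between rivals *)

Lemma is_derive_along (R : realType) (V W : normedModType R)
    (f : V -> R) (g : W -> R) (v a : V) (w b : W) (d : R) :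
  is_derive b w g d -> (forall h : R, f (h *: v + a) = g (h *: w + b)) ->
  is_derive a v f d.
Proof.
move=> [dg <-] fg; have fgab := derive_eq_along fg.
apply: DeriveDef; last exact: fgab.
have := fg 0; rewrite !scale0r !add0r => {}fgab.
move: dg; rewrite /derivable; set G := (G in cvg (G @ _) -> _).
by set F := (F in _ -> cvg (F @ _)); rewrite (_ : F = G) //;
  apply/funext => h; rewrite /F /G /= fg fgab.
Qed.

Lemma is_derive_dir (R : realType) (g : R -> R) (b w : R) :
  derivable g b 1 -> is_derive b w g (w * derive1 g b).
Proof.
move=> /derivable1_diffP dg; apply: DeriveDef; first exact: diff_derivable.
by rewrite derive1E !deriveE // -[w in 'd g b w]mulr1 linearZ.
Qed.

Section SymmetricSlopes.
Variables (R : realType) (n : nat) (M : oligopoly R n) (I : set R).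
Hypothesis hM : model_assumptions M I.
Local Notation view_t := (R * R * 'rV[R]_n.-1)%type.
Local Notation P := (demand M).
Local Notation Px := ('D_(dir_own R n) P).

Lemma demand_differentiable z : view_dom I z -> differentiable P z.
Proof. exact: (smooth_on_differentiable (demand_smooth hM)). Qed.

Lemma demand_differentiable1 (v : view_t) z :
  view_dom I z -> differentiable ('D_v P) z.
Proof.
exact: (smooth_on_differentiable (smooth_on_derive v (demand_smooth hM))).
Qed.

Lemma demand_differentiable2 (u v : view_t) z :
  view_dom I z -> differentiable ('D_u ('D_v P)) z.
Proof.
exact: (smooth_on_differentiable
  (smooth_on_derive u (smooth_on_derive v (demand_smooth hM)))).
Qed.

Lemma derivable_derive1_prod_cost (x : R) :
  0 < x -> derivable (derive1 (prod_cost M)) x 1.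
Proof.
move=> x0; apply/derivable1_diffP.
exact: (smooth_on_differentiable (smooth_onS_derive1 (prod_cost_smooth hM))).
Qed.

Lemma derivable_derive1n2_prod_cost (x : R) :
  0 < x -> derivable (derive1n 2 (prod_cost M)) x 1.
Proof.
move=> x0; apply/derivable1_diffP.
exact: (smooth_on_differentiable
  (smooth_onS_derive1 (smooth_onS_derive1 (prod_cost_smooth hM)))).
Qed.

Definition swap_rivals (m m' : 'I_n.-1) (z : view_t) : view_t :=
  (z.1, col_perm (tperm m m') z.2).

Lemma swap_rivals_linear m m' (h : R) (y z : view_t) :
  swap_rivals m m' (h *: y + z) =
  h *: swap_rivals m m' y + swap_rivals m m' z.
Proof. by congr (_, _); rewrite /= linearP. Qed.

Lemma swap_rivals_sym m m' (a x : R) :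
  swap_rivals m m' (sym_view n a x) = sym_view n a x.
Proof. by congr (_, _); apply/rowP => k; rewrite !mxE. Qed.

Lemma swap_rivals_own m m' : swap_rivals m m' (dir_own R n) = dir_own R n.
Proof. by congr (_, _); apply/rowP => k; rewrite !mxE. Qed.

Lemma swap_rivals_rival m m' :
  swap_rivals m m' (dir_rival R m) = dir_rival R m'.
Proof.
congr (_, _); apply/rowP => k; rewrite !mxE eqxx /=; congr (_%:R).
by rewrite -(inj_eq (@perm_inj _ (tperm m m'))) tpermK tpermL.
Qed.

Lemma demand_swap_rivals m m' z :
  view_dom I z -> P (swap_rivals m m' z) = P z.
Proof. by case: z => [[a x] y] [/= Ia x0 y0]; exact: (demand_sym hM). Qed.

(** The swap fixes the own-output direction, so the invariance of demand passes to its own-output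
    derivative. *)
Lemma demand_own_swap_rivals m m' z :
  view_dom I z -> Px (swap_rivals m m' z) = Px z.
Proof.
move=> zdom; rewrite -[in LHS](swap_rivals_own m m').
exact: (derive_invariant _ (view_dom_open hM) (swap_rivals_linear m m')
  (@demand_swap_rivals m m')).
Qed.

(** Swapping two rivals fixes a symmetric view and exchanges their directions. *)
Lemma demand_rivalE m m' (a x : R) :
  I a -> 0 < x ->
  'D_(dir_rival R m) P (sym_view n a x) =
  'D_(dir_rival R m') P (sym_view n a x).
Proof.
move=> Ia x0; rewrite -(swap_rivals_rival m m') -[in RHS](swap_rivals_sym m m').
apply/esym/(derive_invariant _ (view_dom_open hM) (swap_rivals_linear m m')
  (@demand_swap_rivals m m')).
exact: sym_view_dom.
Qed.

Lemma demand_own_rivalE m m' (a x : R) :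
  I a -> 0 < x ->
  'D_(dir_rival R m) Px (sym_view n a x) =
  'D_(dir_rival R m') Px (sym_view n a x).
Proof.
move=> Ia x0; rewrite -(swap_rivals_rival m m') -[in RHS](swap_rivals_sym m m').
apply/esym/(derive_invariant _ (view_dom_open hM) (swap_rivals_linear m m')
  (@demand_own_swap_rivals m m')).
exact: sym_view_dom.
Qed.

Lemma derive_foc z (v : view_t) :
  view_dom I z ->
  'D_v (foc M) z = 'D_v P z + ('D_v Px z * z.1.2 + Px z * v.1.2)
    - derive1n 2 (prod_cost M) z.1.2 * v.1.2.
Proof.
move=> zdom; have [_ x0 _] := zdom.
have d1 : is_derive z v P ('D_v P z).
  exact/derivableP/diff_derivable/demand_differentiable.
have d2 : is_derive z v Px ('D_v Px z).
  exact/derivableP/diff_derivable/demand_differentiable1.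
have d3 : is_derive z v (fun z => z.1.2) v.1.2.
  exact: (is_derive_along (is_derive_id z.1.2 v.1.2)).
have d4 := is_derive_dir v.1.2 (derivable_derive1_prod_cost x0).
have {}d4 : is_derive z v (fun z : view_t => derive1 (prod_cost M) z.1.2)
    (v.1.2 * derive1n 2 (prod_cost M) z.1.2) by exact: (is_derive_along d4).
have d : is_derive z v (foc M) _ :=
  is_deriveB (is_deriveD d1 (is_deriveM d2 d3)) d4.
have [_ ->] := d; rewrite /GRing.scale /= (mulrC v.1.2); congr (_ + _ - _).
by rewrite addrC [X in X + _]mulrC.
Qed.

Lemma derive_foc_other z (v : view_t) :
  view_dom I z -> v.1.2 = 0 ->
  'D_v (foc M) z = 'D_v P z + 'D_v Px z * z.1.2.
Proof.
move=> zdom v0; rewrite (derive_foc v zdom) v0.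
move: ('D_v P z) ('D_v Px z) (Px z) (derive1n 2 _ _) => p px y c.
by rewrite !mulr0 addr0 subr0.
Qed.

Lemma derive_foc_own z :
  view_dom I z ->
  'D_(dir_own R n) (foc M) z = 2 * Px z + 'D_(dir_own R n) Px z * z.1.2
    - derive1n 2 (prod_cost M) z.1.2.
Proof.
move=> zdom; rewrite (derive_foc _ zdom) -[(dir_own R n).1.2]/(1 : R).
move: ('D_(dir_own R n) P z) ('D_(dir_own R n) Px z) (derive1n 2 _ _)
  => p px c.
by ring.
Qed.

End SymmetricSlopes.

(** * Output responses and derivatives of the Hamiltonian *)

Section SteadyStateConditions.
Variables (R : realType) (n : nat) (M : oligopoly R n) (I : set R).
Hypothesis hM : model_assumptions M I.
Implicit Types (A q k : 'rV[R]_n) (mu D : 'M[R]_n) (i j l : 'I_n).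
Local Notation P := (demand M).
Local Notation Pa := ('D_(dir_state R n) P).
Local Notation Px := ('D_(dir_own R n) P).

Definition own_sym (a x : R) : R :=
  2 * Px (sym_view n a x) + 'D_(dir_own R n) Px (sym_view n a x) * x
  - derive1n 2 (prod_cost M) x.

(** The coefficient b of the output system, read off from the rival [m]; [cross_symE] shows that the
    choice of rival is immaterial. *)
Definition cross_sym (m : 'I_n.-1) (a x : R) : R :=
  'D_(dir_rival R m) P (sym_view n a x)
  + 'D_(dir_rival R m) Px (sym_view n a x) * x.

Definition Psi_sym (a x : R) : R :=
  - (Pa (sym_view n a x) + 'D_(dir_state R n) Px (sym_view n a x) * x).

Lemma own_slope_sym i (a x : R) :
  own_slope M i (const_mx a) (const_mx x) = own_sym a x.
Proof.
by rewrite /own_slope dq_price (dq_view _ _ Px) view_unit_output view_sym mxE.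
Qed.

Lemma cross_slope_sym i m (a x : R) :
  cross_slope M (lift i m) i (const_mx a) (const_mx x) = cross_sym m a x.
Proof.
by rewrite /cross_slope dq_price_lift dq_price (dq_view _ _ Px)
  view_unit_output_lift view_sym mxE.
Qed.

Lemma Psi_symE i (a x : R) :
  Psi M i (const_mx a) (const_mx x) = Psi_sym a x.
Proof.
by rewrite /Psi dA_price dq_price (dA_view _ _ Px) view_unit_state view_sym mxE.
Qed.

Lemma cross_symE m m' (a x : R) :
  I a -> 0 < x -> cross_sym m a x = cross_sym m' a x.
Proof.
move=> Ia x0.
by rewrite /cross_sym (demand_rivalE hM m m' Ia x0)
  (demand_own_rivalE hM m m' Ia x0).
Qed.

Section AtSymmetricProfile.
Variables (a x : R).
Hypotheses (Ia : I a) (x_gt0 : 0 < x).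

Lemma dA_output_foc i j :
  dA j (output_foc M i) (const_mx a) (const_mx x) =
  if j == i then - Psi_sym a x else 0.
Proof.
rewrite output_foc_view dA_view view_sym; case: eqVneq => [->|ji].
  rewrite view_unit_state (derive_foc_other hM (sym_view_dom n Ia x_gt0)) //.
  by rewrite /Psi_sym opprK.
by rewrite (view_unit_state_neq _ ji) derive0.
Qed.

Lemma dq_output_foc_own i :
  dq i (output_foc M i) (const_mx a) (const_mx x) = own_sym a x.
Proof.
rewrite output_foc_view dq_view view_sym view_unit_output.
exact: (derive_foc_own hM (sym_view_dom n Ia x_gt0)).
Qed.

Lemma dq_output_foc_rival i m :
  dq (lift i m) (output_foc M i) (const_mx a) (const_mx x) = cross_sym m a x.
Proof.
rewrite output_foc_view dq_view view_sym view_unit_output_lift.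
exact: (derive_foc_other hM (sym_view_dom n Ia x_gt0)).
Qed.

(** With a on the diagonal and b elsewhere, the output system has eigenvalues a - b and a + (n-1)b;
    [Delta] is their product. *)
Lemma Delta_factor l j :
  (2 <= n)%N ->
  Delta M l j (const_mx a) (const_mx x) =
  (own_slope M l (const_mx a) (const_mx x)
   - cross_slope M l j (const_mx a) (const_mx x)) *
  (own_slope M l (const_mx a) (const_mx x)
   + (n - 1)%:R * cross_slope M l j (const_mx a) (const_mx x)).
Proof.
move=> n2; rewrite /Delta (natrB _ n2) (natrB _ (ltnW n2)).
move: (own_slope M l _ _) (cross_slope M l j _ _) => al be.
by ring.
Qed.

(** Let S be the sum of column [j] of [D]. Row i reads (a - b) D_ij + b S = Psi if i = j, and 0
    otherwise; adding all rows gives (a + (n-1)b) S = Psi. Row [l] times a + (n-1)b then yields the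
    claim without any division. *)
Lemma output_response_rival D l j :
  (2 <= n)%N -> output_response M (const_mx a) (const_mx x) D -> l != j ->
  Delta M l j (const_mx a) (const_mx x) * D l j =
  - (cross_slope M l j (const_mx a) (const_mx x)
     * Psi M j (const_mx a) (const_mx x)).
Proof.
move=> n2 resp lj; have [m lE|lE] := unliftP j l; last by rewrite lE eqxx in lj.
rewrite Delta_factor // Psi_symE own_slope_sym lE cross_slope_sym -{}lE.
have cross l' i : l' != i ->
    dq l' (output_foc M i) (const_mx a) (const_mx x) = cross_sym m a x.
  have [m' -> _|->] := unliftP i l'; last by rewrite eqxx.
  by rewrite dq_output_foc_rival (cross_symE m' m Ia x_gt0).
have foc i : own_sym a x * D i j
    + cross_sym m a x * \sum_(l' | l' != i) D l' j =
    if i == j then Psi_sym a x else 0.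
  have := resp j i; rewrite dA_output_foc (bigD1 i) //= dq_output_foc_own.
  under eq_bigr => l' l'i do rewrite (cross l' i l'i).
  rewrite -mulr_sumr (eq_sym j); case: eqP => _ /eqP;
    last by rewrite add0r => /eqP.
  by rewrite addr_eq0 eqr_opp => /eqP <-.
move: (own_sym a x) (cross_sym m a x) (Psi_sym a x) foc => al be psi foc.
pose S := \sum_i D i j.
have row i : (al - be) * D i j + be * S = if i == j then psi else 0.
  by rewrite -foc /S (bigD1 i) //=; ring.
have total : (al + (n - 1)%:R * be) * S = psi.
  have -> : psi = \sum_i if i == j then psi else 0.
    by rewrite -big_mkcond big_pred1_eq.
  rewrite -(eq_bigr _ (fun i _ => row i)) big_split /= -mulr_sumr sumr_const.
  by rewrite card_ord -mulr_natl (natrB _ (ltnW n2)) -/S; ring.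
have := row l; rewrite (negPf lj) => row0.
rewrite -total; apply/eqP; rewrite -subr_eq0; apply/eqP.
rewrite -[RHS](mulr0 (al + (n - 1)%:R * be)) -row0.
by ring.
Qed.

End AtSymmetricProfile.

Lemma hamiltonianE i A q k mu :
  hamiltonian M i A q k mu =
  price M i A q * q 0 i - prod_cost M (q 0 i) - adv_cost M (k 0 i)
  + \sum_l mu i l * (accum_of M l k - decay M * A 0 l).
Proof. by rewrite (bigD1 i) //= addrA. Qed.

(** Along A_j the Hamiltonian changes by q_i times the change of p_i, plus a linear term from the
    state equation of firm [j]; hence [derive_affine]. The cases [j = i] and [j != i] coincide. *)
Lemma dH_dAE i j A q k mu :
  view_dom I (view i A q) ->
  dH_dA M i j A q k mu = dA j (price M i) A q * q 0 i - decay M * mu i j.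
Proof.
move=> zdom.
rewrite -[price M i]/(fun A' q' => demand M (view i A' q')) dA_view.
rewrite mulrC -mulNr; apply: derive_affine => [|h].
  exact/diff_derivable/(demand_differentiable hM).
rewrite !hamiltonianE -[price M i _ q]/(demand M (view i (h *: _ + A) q)).
have <- := view_linear i h (unit_row R j) 0 A q; rewrite scaler0 add0r.
rewrite -/(price M i A q) -[demand M (view i A q)]/(price M i A q).
have -> : \sum_l mu i l
      * (accum_of M l k - decay M * (h *: unit_row R j + A) 0 l)
  = \sum_l mu i l * (accum_of M l k - decay M * A 0 l) - h * decay M * mu i j.
  rewrite (bigD1 j) // [in RHS](bigD1 j) //= !mxE !eqxx /= mulr1.
  rewrite (eq_bigr (fun l => mu i l * (accum_of M l k - decay M * A 0 l))).
    by ring.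
  by move=> l lj; rewrite !mxE (negPf lj) andbF mulr0 add0r.
by ring.
Qed.

Lemma dH_dqE i l A q k mu :
  view_dom I (view i A q) -> l != i ->
  dH_dq M i l A q k mu = dq l (price M i) A q * q 0 i.
Proof.
move=> zdom li.
rewrite -[price M i]/(fun A' q' => demand M (view i A' q')) dq_view.
rewrite mulrC -[RHS]addr0; apply: derive_affine => [|h].
  exact/diff_derivable/(demand_differentiable hM).
rewrite !hamiltonianE -[price M i A _]/(demand M (view i A (h *: _ + q))).
have <- := view_linear i h 0 (unit_row R l) A q; rewrite scaler0 add0r.
rewrite -[price M i A q]/(demand M (view i A q)).
have -> : (h *: unit_row R l + q) 0 i = q 0 i.
  by rewrite !mxE (eq_sym i) (negPf li) andbF mulr0 add0r.
by ring.
Qed.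

End SteadyStateConditions.

(** * Steady states of the two concepts and their comparison *)

Section SteadyStates.
Variables (R : realType) (n : nat) (M : oligopoly R n) (I : set R).
Variables (qs ks : R -> R).
Hypotheses (n_ge2 : (2 <= n)%N) (hM : model_assumptions M I).
Hypotheses (nsp : no_spillover M).
Hypotheses (hqs : symmetric_output M I qs) (hks : symmetric_investment M I ks).
Hypothesis Delta_gt0 : forall a, I a -> forall i j : 'I_n, j != i ->
  0 < Delta M i j (symA n a) (symq n qs a).
Implicit Types (i j l : 'I_n) (a : R).
Local Notation P := (demand M).
Local Notation Pa := ('D_(dir_state R n) P).
Local Notation Px := ('D_(dir_own R n) P).
Local Notation w := (fun a => sym_view n a (qs a)).

Lemma rivals_investment_const i (k : R) :
  rivals_investment i (const_mx k) = (n - 1)%:R * k.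
Proof.
rewrite /rivals_investment (eq_bigr (fun=> k)) => [|j _]; last by rewrite mxE.
by rewrite sumr_const cardC1 card_ord subn1 mulr_natl.
Qed.

Lemma F_openE i a : F_open M qs i a = Pa (w a) * qs a.
Proof. by rewrite /F_open dA_price view_sym. Qed.

Lemma sym_view_differentiable a :
  I a -> differentiable (fun b => sym_view n b (qs b)) a.
Proof.
move=> Ia; have [_ _ _ /derivable1_diffP dq] := hqs Ia.
(* The symmetric view is linear in the pair [(b, qs b)]. *)
have -> : w = (fun b => b *: dir_state R n) +
              (fun b => qs b *: sym_view n 0 1).
  apply/funext => b; congr (_, _, _) => /=; rewrite ?scaler0 ?add0r ?addr0.
  - by rewrite [RHS]mulr1.
  - by rewrite [RHS]mulr1.
  - by apply/rowP => m; rewrite !mxE mulr1.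
by apply: differentiableD; apply: differentiableZl.
Qed.

Lemma demand_sym_view_differentiable a (v : R * R * 'rV[R]_n.-1) :
  I a -> differentiable (fun b => 'D_v P (w b)) a.
Proof.
move=> Ia; have [q0 _ _ _] := hqs Ia.
apply: (@differentiable_comp _ _ _ _ w ('D_v P)).
  exact: sym_view_differentiable.
exact/(demand_differentiable1 hM)/sym_view_dom.
Qed.

Lemma F_open_derivable i a : I a -> derivable (F_open M qs i) a 1.
Proof.
move=> Ia; have [_ _ _ /derivable1_diffP dq] := hqs Ia.
apply/derivable1_diffP.
have -> : F_open M qs i = (fun b => Pa (w b)) * qs.
  by apply/funext => b; rewrite F_openE.
by apply: differentiableM => //; exact: demand_sym_view_differentiable.
Qed.

Lemma own_sym_continuous a :
  I a -> {for a, continuous (fun b => own_sym M b (qs b))}.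
Proof.
move=> Ia; have [q0 _ _ /derivable1_diffP dq] := hqs Ia.
apply: differentiable_continuous.
have d1 := demand_sym_view_differentiable (dir_own R n) Ia.
have d2 : differentiable (fun b => 'D_(dir_own R n) Px (w b)) a.
  apply: (@differentiable_comp _ _ _ _ w ('D_(dir_own R n) Px)).
    exact: sym_view_differentiable.
  exact/(demand_differentiable2 hM)/sym_view_dom.
have d3 : differentiable (fun b => derive1n 2 (prod_cost M) (qs b)) a.
  apply: (@differentiable_comp _ _ _ _ qs (derive1n 2 (prod_cost M))) => //.
  exact/derivable1_diffP/(derivable_derive1n2_prod_cost hM).
exact: (differentiableB (differentiableD
  (differentiableM (differentiable_cst (2 : R) a) d1)
  (differentiableM d2 dq)) d3).
Qed.

(** If the own slope were zero, [Delta] would equal -(n-1)b^2, which is not positive. *)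
Lemma own_sym_neq0 a : I a -> own_sym M a (qs a) != 0.
Proof.
move=> Ia; have i1 : (1 < n)%N by [].
pose i : 'I_n := Ordinal (ltnW n_ge2); pose j : 'I_n := Ordinal i1.
have := Delta_gt0 Ia (i := i) (j := j) isT.
rewrite /Delta -(own_slope_sym M i a (qs a)) /symA /symq.
move: (own_slope _ _ _ _) (cross_slope _ _ _ _ _) => al be.
apply: contraTneq => ->; rewrite mul0r sub0r -leNgt oppr_le0.
by rewrite mulr_ge0 // sqr_ge0.
Qed.

(** The second order condition is known only along solutions; this extends its output part to every
    state in [I]. *)
Lemma own_sym_lt0 a b :
  I a -> I b -> own_sym M a (qs a) < 0 -> own_sym M b (qs b) < 0.
Proof.
exact: (continuous_nonvanishing_lt0 (interval_states hM) own_sym_continuous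
  own_sym_neq0).
Qed.

(** Stationarity of the state gives Gamma = delta a. Uniqueness in [hks] and [hqs] then fixes
    investment and output, and the investment condition fixes lambda_ii. Time 1 stands for any
    positive time, where the differential equations hold. *)
Lemma steady_profile (x : Defs.path R n) a :
  I a -> common_conditions M x -> symmetric_path x ->
  (forall t : R, 0 < t ->
    forall i, is_derive t 1 (fun s => state x s 0 i) (0 : R)) ->
  (forall (t : R) i, 0 <= t -> state x t 0 i = a) ->
  [/\ state x 1 = const_mx a, output x 1 = const_mx (qs a),
      own_sym M a (qs a) < 0 &
      forall i, costate x 1 i i = steady_costate M (ks a)].
Proof.
move=> Ia [conds _ _ evol] symm steady stA.
have ge01 : 0 <= 1 :> R by [].
have [q0 k0 foc soc] := conds 1 ge01.
have [_ symq symk _ _] := symm 1 ge01.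
pose i0 : 'I_n := Ordinal (ltnW n_ge2).
have eA : state x 1 = const_mx a by apply/rowP => j; rewrite mxE stA.
have [y y0 eq'] : exists2 y, 0 < y & output x 1 = const_mx y.
  exists (output x 1 0 i0); first exact: q0.
  by apply/rowP => j; rewrite mxE; exact: symq.
have [k kpos ek'] : exists2 k, 0 < k & invest x 1 = const_mx k.
  exists (invest x 1 0 i0); first exact: k0.
  by apply/rowP => j; rewrite mxE; exact: symk.
have [_ _ quniq _] := hqs Ia; have [_ _ kuniq _] := hks Ia.
have eq : output x 1 = const_mx (qs a).
  rewrite eq'; congr const_mx; apply: quniq => // i.
  by have [+ _] := foc i; rewrite eA eq'.
have ek : invest x 1 = const_mx (ks a).
  rewrite ek'; congr const_mx; apply: kuniq => //.
  have [_ d0] := steady 1 ltr01 i0; have [_] := evol 1 ltr01 i0.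
  rewrite d0 eA mxE /accum_of ek' rivals_investment_const mxE.
  by move/esym/eqP; rewrite subr_eq0 => /eqP.
split=> // [|i].
  by have [+ _] := soc i0; rewrite eA eq own_slope_sym.
have [_] := foc i; rewrite ek rivals_investment_const mxE.
have [ka0 _ _ _] := hks Ia.
have gk := accum_k_gt0 hM ka0 (rivals_gt0 n_ge2 ka0).
rewrite (accum_kE hM nsp ka0 (rivals_gt0 n_ge2 ka0)) in gk *.
rewrite addrC => /eqP; rewrite subr_eq0 /steady_costate => /eqP <-.
by rewrite mulfK // lt0r_neq0.
Qed.

(** The diagonal adjoint equation at rest is 0 = rho lambda_ii - (F - delta lambda_ii). *)
Lemma open_loop_steady_level a i :
  I a -> steady_state_value (open_loop_solution M) a ->
  F_open M qs i a = adjoint_level M ks a.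
Proof.
move=> Ia [x [[conds adj] symm steady stA]].
have [eA eq _ mu] :=
  steady_profile Ia conds symm (fun t t0 => (steady t t0).1) stA.
have [_ d0] := (steady 1 ltr01).2 i i; have [_] := adj 1 ltr01 i i.
rewrite d0 /open_loop_adjoint eA eq.
rewrite (dH_dAE hM) ?view_sym; last first.
  by have [q0 _ _ _] := hqs Ia; exact: sym_view_dom.
rewrite mu mxE -[_ * qs a]/(F_open M qs i a) /adjoint_level.
move: (F_open M qs i a) => F /esym/eqP; rewrite subr_eq0 => /eqP e.
by rewrite mulrDl e; ring.
Qed.

Lemma closed_loop_steady_level a i :
  I a -> steady_state_value (closed_loop_solution M) a ->
  own_sym M a (qs a) < 0 /\ exists2 D : 'M[R]_n,
    output_response M (const_mx a) (const_mx (qs a)) D &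
    adjoint_level M ks a = F_open M qs i a
      + \sum_(l | l != i)
          dq l (price M i) (const_mx a) (const_mx (qs a)) * qs a * D l i.
Proof.
move=> Ia [x [[conds adj] symm steady stA]].
have [eA eq own0 mu] :=
  steady_profile Ia conds symm (fun t t0 => (steady t t0).1) stA.
split=> //; have [D] := adj 1 ltr01; rewrite eA eq => resp adjD; exists D => //.
have [_ d0] := (steady 1 ltr01).2 i i; have [_] := adjD i i.
have vdom : view_dom I (view i (const_mx a) (const_mx (qs a))).
  by rewrite view_sym; have [q0 _ _ _] := hqs Ia; exact: sym_view_dom.
rewrite d0 /closed_loop_adjoint (dH_dAE hM _ _ _ vdom) mu.
rewrite (mxE _ _ 0 i) -[_ * qs a]/(F_open M qs i a) /adjoint_level.
(* The investment feedback vanishes because [dk_dA] is 0. *)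
rewrite [X in _ - X - _]big1 => [|l _]; last exact: mulr0.
under eq_bigr => l li do rewrite (dH_dqE hM _ _ vdom li) mxE.
move: (F_open M qs i a) (\sum_(_ | _) _) => F S.
by move/esym/eqP; rewrite subr_eq0 subr0 => /eqP <-; ring.
Qed.

(** Since Psi < 0 < Delta, each response dq_l/dA_i has the sign of b, while dp_i/dq_l < 0. All
    feedback terms thus have the sign opposite to b. *)
Lemma closed_loop_steady_sign a i :
  I a -> steady_state_value (closed_loop_solution M) a ->
  (strategic_substitutes M I -> F_open M qs i a < adjoint_level M ks a) /\
  (strategic_complements M I -> adjoint_level M ks a < F_open M qs i a).
Proof.
move=> Ia st; have [_ [D resp ->]] := closed_loop_steady_level i Ia st.
have [q0 _ _ _] := hqs Ia.
have adm : admissible I (const_mx a : 'rV[R]_n) (const_mx (qs a)).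
  by split=> j; rewrite mxE.
(* One actual rival makes the sum of feedback terms nonzero, so the inequality is strict. *)
have [j ji] : exists j : 'I_n, j != i.
  pose j0 : 'I_n := Ordinal (ltnW n_ge2); pose j1 : 'I_n := Ordinal n_ge2.
  by case: (eqVneq j0 i) => [<-|?]; [exists j1|exists j0].
have Psi0 : Psi M i (const_mx a) (const_mx (qs a)) < 0.
  by rewrite /Psi oppr_lt0; exact: (dp_state_output_gt0 hM).
have resp' l : l != i ->
    Delta M l i (const_mx a) (const_mx (qs a)) * D l i =
    - (cross_slope M l i (const_mx a) (const_mx (qs a))
       * Psi M i (const_mx a) (const_mx (qs a))).
  exact: (output_response_rival hM Ia q0).
have dp l : l != i ->
    dq l (price M i) (const_mx a) (const_mx (qs a)) * qs a < 0.
  by move=> li; rewrite pmulr_llt0 //; exact: (dp_cross_lt0 hM).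
have Del l : l != i -> 0 < Delta M l i (const_mx a) (const_mx (qs a)).
  by move=> li; apply: Delta_gt0; rewrite // eq_sym.
split=> strat.
  have term l : l != i ->
      0 < dq l (price M i) (const_mx a) (const_mx (qs a)) * qs a * D l i.
    move=> li; rewrite (nmulr_rgt0 _ (dp l li)) -(pmulr_rlt0 _ (Del l li)).
    rewrite (resp' l li) oppr_lt0 (nmulr_lgt0 _ Psi0).
    by apply: strat => //; rewrite eq_sym.
  rewrite ltrDl (bigD1 j ji) /=; apply: ltr_pwDl; first exact: term.
  by apply: sumr_ge0 => l /andP[li _]; exact/ltW/term.
have term l : l != i ->
    dq l (price M i) (const_mx a) (const_mx (qs a)) * qs a * D l i < 0.
  move=> li; rewrite (nmulr_rlt0 _ (dp l li)) -(pmulr_rgt0 _ (Del l li)).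
  rewrite (resp' l li) oppr_gt0 (nmulr_llt0 _ Psi0).
  by apply: strat => //; rewrite eq_sym.
rewrite gtrDl (bigD1 j ji) /=; apply: ltr_nwDl; first exact: term.
by apply: sumr_le0 => l /andP[li _]; exact/ltW/term.
Qed.

(** Converse of [open_loop_steady_level], realised by a constant path. *)
Lemma open_loop_steady_exists a i :
  I a -> own_sym M a (qs a) < 0 -> F_open M qs i a = adjoint_level M ks a ->
  steady_state_value (open_loop_solution M) a.
Proof.
move=> Ia own0 Fa; have [q0 foc _ _] := hqs Ia; have [k0 acc _ _] := hks Ia.
(* Zero off-diagonal costates satisfy their adjoint equations because p_i does not depend on A_j for
   j != i. *)
pose mu : 'M[R]_n :=
  \matrix_(i, j) if i == j then steady_costate M (ks a) else 0.
have K0 := rivals_gt0 n_ge2 k0.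
have gk := accum_k_gt0 hM k0 K0.
have [rho0 del0] := (discount_gt0 hM, decay_gt0 hM).
have muii j : mu j j = steady_costate M (ks a) by rewrite mxE eqxx.
have cst (z : R) j : (const_mx z : 'rV[R]_n) 0 j = z by rewrite mxE.
have vdom j : view_dom I (view j (const_mx a) (const_mx (qs a))).
  by rewrite view_sym; exact: sym_view_dom.
exists (Defs.Path (fun=> const_mx a) (fun=> const_mx (qs a))
  (fun=> const_mx (ks a)) (fun=> mu)); split=> /=.
- split; first split=> /=.
  + move=> t _; split=> j; rewrite ?cst; [exact: q0|exact: k0| |]; split.
    * exact: foc.
    * rewrite rivals_investment_const muii (accum_kE hM nsp k0 K0).
      rewrite (accum_kE hM nsp k0 K0) in gk.
      by rewrite divfK ?addNr // lt0r_neq0.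
    * by rewrite own_slope_sym.
    * rewrite rivals_investment_const muii.
      have c2 := adv_cost''_gt0 hM k0.
      have c1 := adv_cost'_gt0 hM k0.
      have gkk := accum_kk_le0 hM k0 K0.
      have : 0 < steady_costate M (ks a).
        by rewrite divr_gt0 // -(accum_kE hM nsp k0 K0).
      move: (steady_costate _ _) (derive1n 2 _ _) (accum_kk _ _ _) c2 gkk
        => lam c gkk c0 gkk0 lam0.
      by nra.
  + by move=> j t; exact: cst_continuous.
  + by move=> j l t; exact: cst_continuous.
  + move=> t t0 j; rewrite /accum_of rivals_investment_const !cst acc subrr.
    exact: is_derive_cst.
  + move=> t t0 j l; rewrite /open_loop_adjoint (dH_dAE hM _ _ _ (vdom j)) cst.
    set r := (X in is_derive _ _ _ X).
    suff -> : r = 0 by exact: is_derive_cst.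
    rewrite {}/r; have [<-|jl] := eqVneq j l.
      rewrite mxE eqxx -[_ * qs a]/(F_open M qs j a) F_openE -(F_openE i) Fa.
      by rewrite /adjoint_level; ring.
    rewrite mxE (negPf jl) (dA_price_neq M) 1?eq_sym //.
    by rewrite mul0r !mulr0 subrr subr0.
- move=> t _; split=> [j l|j l|j l|j l|j l j' l' lj lj'].
  1-3: by rewrite !cst.
    by rewrite !muii.
  by rewrite !mxE eq_sym (negPf lj) eq_sym (negPf lj').
- by move=> t t0; split=> *; exact: is_derive_cst.
- by move=> t j _; exact: cst.
Qed.

(** With X > 0 the upper right entry, the determinant is X F' - delta (rho + delta), so it is
    negative exactly when F' < delta (rho + delta) / X, the slope of [adjoint_level]. *)
Lemma saddle_slope (F : R -> R) a :
  I a -> saddle M ks F a -> derive1 F a < derive1 (adjoint_level M ks) a.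
Proof.
move=> Ia; rewrite /saddle.
have [k0 _ _ _] := hks Ia; have K0 := rivals_gt0 n_ge2 k0.
have [_] := is_derive_adjoint_level hM nsp n_ge2 hks Ia.
rewrite -derive1E => ->.
have gk := accum_k_gt0 hM k0 K0; have gkk := accum_kk_le0 hM k0 K0.
have c2 := adv_cost''_gt0 hM k0; have c1 := adv_cost'_gt0 hM k0.
have del0 := decay_gt0 hM; have rho0 := discount_gt0 hM.
rewrite (expand_det_row _ 0) !big_ord_recl big_ord0 /cofactor !det_mx11 !mxE /=.

rewrite /= in c2; move: (derive1 F a) (accum_k M _ _) (accum_kk M _ _) gk gkk
  => F' g g' g0 g'0.
move: (derive1 (derive1 (adv_cost M)) _) (derive1 (adv_cost M) _) c2 c1
  => c2 c1 c20 c10.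
have X0 : 0 < g ^+ 3 / (c2 * g - c1 * g').
  by rewrite divr_gt0 ?exprn_gt0 //; nra.
move: (g ^+ 3 / _) X0 => X X0; rewrite ltr_pdivlMr // addn0 expr0 expr1.
lra.
Qed.

Lemma open_loop_steady_side i (Aol Acl : R) :
  unique_steady_state_value I (open_loop_solution M) Aol ->
  saddle M ks (F_open M qs i) Aol -> I Acl -> own_sym M Acl (qs Acl) < 0 ->
  (F_open M qs i Acl < adjoint_level M ks Acl -> Aol < Acl) /\
  (adjoint_level M ks Acl < F_open M qs i Acl -> Acl < Aol).
Proof.
move=> [Io sto uniq] sad Ic own0.
have dh z : I z -> is_derive z 1 (F_open M qs i - adjoint_level M ks)
    (derive1 (F_open M qs i) z - derive1 (adjoint_level M ks) z).
  move=> Iz; apply: is_deriveB; apply: is_derive1P;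
    first exact: F_open_derivable.
  by have [] := is_derive_adjoint_level hM nsp n_ge2 hks Iz.
have zero z : (F_open M qs i - adjoint_level M ks) z = 0 ->
    F_open M qs i z = adjoint_level M ks z.
  by move=> /eqP; rewrite subr_eq0 => /eqP.
have [|||||Hlt Hgt] := @downward_crossing _ I
  (F_open M qs i - adjoint_level M ks) Aol (interval_states hM) _ Io _ _ _ _
  Acl Ic.
- move=> z Iz; apply/differentiable_continuous/derivable1_diffP.
  by have [] := dh z Iz.
- rewrite -[LHS]/(_ - _) (open_loop_steady_level i Io sto); exact: subrr.
(* Any zero in [I] carries an open-loop steady state, the own slope at [z] getting its sign from
   [Acl]. *)
- move=> z Iz /zero hz; apply: uniq => //.
  exact: (open_loop_steady_exists Iz (own_sym_lt0 Ic Iz own0) hz).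
- by have [] := dh _ Io.
- have [_ e] := dh _ Io; rewrite derive1E e subr_lt0; exact: saddle_slope.
split=> h; first by apply: Hlt; rewrite -subr_lt0 in h.
by apply: Hgt; rewrite -subr_gt0 in h.
Qed.

End SteadyStates.

Unset Implicit Arguments.

Theorem proposition1 (R : realType) (n : nat) (M : oligopoly R n)
    (I : set R) (qs ks own cross : R -> R) (Aol Acl : R) :
  (2 <= n)%N ->
  model_assumptions M I ->
  no_spillover M ->
  symmetric_output M I qs ->
  symmetric_investment M I ks ->
  (forall a, I a -> forall i j : 'I_n, j != i ->
     0 < Delta M i j (symA n a) (symq n qs a)) ->
  symmetric_output_response M I qs own cross ->
  unique_steady_state_value I (open_loop_solution M) Aol ->
  unique_steady_state_value I (closed_loop_solution M) Acl ->
  (forall i : 'I_n, saddle M ks (F_open M qs i) Aol) ->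
  (forall i j : 'I_n, j != i ->
     saddle M ks (F_closed M qs cross i j) Acl) ->
  (strategic_substitutes M I -> Aol < Acl) /\
  (strategic_complements M I -> Acl < Aol).
Proof.
move=> n2 hM nsp hqs hks Del _ ol [Icl stcl _] sad _.
pose i : 'I_n := Ordinal (ltnW n2).
(* The closed-loop steady state supplies the one point where the own slope is known to be
   negative. *)
have [own0 _] := closed_loop_steady_level n2 hM nsp hqs hks i Icl stcl.
have [sub comp] := closed_loop_steady_sign n2 hM nsp hqs hks Del i Icl stcl.
have [above below] :=
  open_loop_steady_side n2 hM nsp hqs hks Del ol (sad i) Icl own0.
by split=> [/sub /above|/comp /below].
Qed.
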